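(* Let $F$ be a subset of $\mathbb{Z}^d$ such that $$\sum_{v\in F\setminus\{0\}}\|v\|^{-\sigma}=\infty$$ holds for every $0<\sigma<d$. Then $F$ contains $(k,\epsilon,\mathbf{e})$-APs for every $k\ge 3$, $0<\epsilon<1$, and orthonormal basis $\mathbf{e}$ of $\mathbb{R}^d$.
   Context: $\|\cdot\|$ is the Euclidean norm on $\mathbb{R}^d$. Let $\mathbf{e}=\{e_1,\ldots,e_m\}$ be a linearly independent set of vectors in $\mathbb{R}^d$, $1\le m\le d$. For $k\in\mathbb{N}$ and $\Delta>0$, a set $P\subset\mathbb{R}^d$ is an arithmetic patch of size $k$ and scale $\Delta$ with respect to orientation $\mathbf{e}$ if $$P=\Big\{t+\Delta\sum_{i=1}^m x_ie_i : x_i=0,1,\ldots,k-1\Big\}$$ for some $t\in\mathbb{R}^d$. For $\epsilon\in[0,1)$, a set $Q\subset\mathbb{R}^d$ is a $(k,\epsilon,\mathbf{e})$-AP if there exists an arithmetic patch $P$ of size $k$ and some scale $\Delta>0$ with respect to orientation $\mathbf{e}$ such that $\#Q=\#P$ and $$\sup_{x\in P}\inf_{y\in Q}\|x-y\|\le\epsilon\Delta.$$ $F$ contains $(k,\epsilon,\mathbf{e})$-APs if some subset $Q\subseteq F$ is a $(k,\epsilon,\mathbf{e})$-AP. *)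

(* Defs.v *)
From mathcomp Require Import all_boot all_order all_algebra.
From mathcomp Require Import all_classical all_reals all_analysis.

Set Implicit Arguments.
Unset Strict Implicit.
Unset Printing Implicit Defensive.

Import Order.TTheory GRing.Theory Num.Theory.

Local Open Scope classical_set_scope.
Local Open Scope ring_scope.

Definition dotv (R : realType) (d : nat) (u v : 'rV[R]_d) : R :=
  \sum_(j < d) u 0 j * v 0 j.

(* The norm `|v| that the library puts on row vectors is the sup norm. *)
Definition enorm (R : realType) (d : nat) (v : 'rV[R]_d) : R :=
  Num.sqrt (dotv v v).

Definition orthonormal_basis (R : realType) (d : nat)
    (e : d.-tuple 'rV[R]_d) : Prop :=
  basis_of fullv e /\
  forall i j : 'I_d, dotv (tnth e i) (tnth e j) = (i == j)%:R.

Definition integer_lattice (R : realType) (d : nat) : set 'rV[R]_d :=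
  [set v | v \is a mxOver Num.int].

(* The three notions below are meant for a linearly independent orientation e
   with 1 <= m. *)
Definition arithmetic_patch (R : realType) (d m : nat)
    (e : m.-tuple 'rV[R]_d) (k : nat) (Delta : R) (P : set 'rV[R]_d) : Prop :=
  exists t : 'rV[R]_d,
    P = [set t + Delta *: \sum_(i < m) (x i)%:R *: tnth e i
        | x in [set: {ffun 'I_m -> 'I_k}]].

Definition is_AP (R : realType) (d m : nat) (k : nat) (eps : R)
    (e : m.-tuple 'rV[R]_d) (Q : set 'rV[R]_d) : Prop :=
  exists (Delta : R) (P : set 'rV[R]_d),
    [/\ 0 < Delta,
        arithmetic_patch e k Delta P,
        (Q #= P)%card &
        (ereal_sup [set ereal_inf [set (enorm (x - y))%:E | y in Q] | x in P]
           <= (eps * Delta)%:E)%E].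

Definition contains_APs (R : realType) (d m : nat) (k : nat) (eps : R)
    (e : m.-tuple 'rV[R]_d) (F : set 'rV[R]_d) : Prop :=
  exists Q : set 'rV[R]_d, Q `<=` F /\ is_AP k eps e Q.

(* Main.v *)
Require Import Defs.
From mathcomp Require Import all_boot all_order all_algebra.
From mathcomp Require Import all_classical all_reals all_analysis.
From mathcomp Require Import ring lra.

Set Implicit Arguments.
Unset Strict Implicit.
Unset Printing Implicit Defensive.

Import Order.TTheory GRing.Theory Num.Theory.

Local Open Scope classical_set_scope.
Local Open Scope ring_scope.

(** If [F] contains no approximate patch, then [F] is so sparse at every scale
    that the sum converges for some exponent below [d].

    Choose an integer [m >= d / eps] and put [M = m * k].  Cut a box with sides
    parallel to [e] into [M ^ d] cells of side [l].  The [k ^ d] cells whose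
    indices are multiples of [m] have as corners the points of a patch of scale
    [m * l]; if each of them contained a point of [F], these points would lie
    within [d * l <= eps * (m * l)] of the patch ([subboxes_AP]).  So every such
    box has a cell that misses [F] ([no_AP_porous]).

    This holds for all boxes, hence again inside each cell that survives.  Two
    distinct lattice points cannot lie in one box of side [s = 1 / (d + 1)], as
    they are at distance at least 1.  Therefore a box of side [s * M ^ n] has
    at most [(M ^ d - 1) ^ n] points of [F] ([porous_count]).

    Since [ln (M ^ d - 1) / ln M < d], some exponent [sigma] lies strictly
    between these two numbers ([subcritical_exponent]).  Split [F] without the
    origin into the shells between consecutive centred boxes of sides
    [s * M ^ n]: their contributions to the sum with exponent [sigma] are
    dominated by a convergent geometric series ([porous_sum_lty]), which
    contradicts the hypothesis at [sigma]. *)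

(** * Coordinates in an orthonormal basis *)

Lemma dotvBl (R : realType) (d : nat) (u v w : 'rV[R]_d) :
  dotv (u - v) w = dotv u w - dotv v w.
Proof.
rewrite /dotv -sumrB; apply: eq_bigr => j _.
by rewrite !mxE mulrDl mulNr.
Qed.

Lemma dotvDl (R : realType) (d : nat) (u v w : 'rV[R]_d) :
  dotv (u + v) w = dotv u w + dotv v w.
Proof.
by rewrite /dotv -big_split; apply: eq_bigr => j _; rewrite !mxE mulrDl.
Qed.

Lemma dotvZl (R : realType) (d : nat) (c : R) (u w : 'rV[R]_d) :
  dotv (c *: u) w = c * dotv u w.
Proof.
by rewrite /dotv mulr_sumr; apply: eq_bigr => j _; rewrite !mxE mulrA.
Qed.

Lemma dotv_combination (R : realType) (d : nat) (e : d.-tuple 'rV[R]_d)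
    (c : 'I_d -> R) (i : 'I_d) :
  orthonormal_basis e -> dotv (\sum_j c j *: tnth e j) (tnth e i) = c i.
Proof.
move=> [_ he].
have dot_sum (r : seq 'I_d) : dotv (\sum_(j <- r) c j *: tnth e j) (tnth e i)
    = \sum_(j <- r) c j * (j == i)%:R.
  elim: r => [|j r IH].
    by rewrite !big_nil /dotv big1// => j _; rewrite mxE mul0r.
  by rewrite !big_cons dotvDl dotvZl he IH.
rewrite dot_sum (bigD1 i)//= eqxx mulr1 big1 ?addr0// => j /negbTE ->.
by rewrite mulr0.
Qed.

(** Parseval's identity: the matrix [E] whose rows are the basis satisfies
    [E *m E^T = 1], hence also [E^T *m E = 1]. *)
Lemma parseval (R : realType) (d : nat) (e : d.-tuple 'rV[R]_d)
    (v : 'rV[R]_d) :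
  orthonormal_basis e -> dotv v v = \sum_i dotv v (tnth e i) ^+ 2.
Proof.
move=> [_ he]; pose E : 'M[R]_d := \matrix_(i, j) tnth e i 0 j.
have EEt : E *m E^T = 1%:M.
  apply/matrixP => i j; rewrite !mxE -he /dotv.
  by apply: eq_bigr => l _; rewrite !mxE.
have -> : dotv v v = (v *m E^T *m (v *m E^T)^T) 0 0.
  rewrite trmx_mul trmxK mulmxA -(mulmxA v) (mulmx1C EEt) mulmx1 mxE.
  by apply: eq_bigr => j _; rewrite !mxE.
rewrite mxE; apply: eq_bigr => i _; rewrite !mxE expr2.
by congr (_ * _); apply: eq_bigr => j _; rewrite !mxE.
Qed.

Lemma enorm_ge0 (R : realType) (d : nat) (v : 'rV[R]_d) : 0 <= enorm v.
Proof. exact: sqrtr_ge0. Qed.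

Lemma ler_coord_enorm (R : realType) (d : nat) (e : d.-tuple 'rV[R]_d)
    (v : 'rV[R]_d) (i : 'I_d) :
  orthonormal_basis e -> `|dotv v (tnth e i)| <= enorm v.
Proof.
move=> he; rewrite -sqrtr_sqr /enorm ler_wsqrtr// (parseval _ he).
by rewrite (bigD1 i)//= lerDl sumr_ge0// => j _; rewrite sqr_ge0.
Qed.

(** The sharp constant is [Num.sqrt d%:R]; the cruder factor [d] keeps the
    later choices of mesh sizes rational. *)
Lemma ler_enorm_coords (R : realType) (d : nat) (e : d.-tuple 'rV[R]_d)
    (v : 'rV[R]_d) (c : R) :
  orthonormal_basis e -> 0 <= c ->
  (forall i, `|dotv v (tnth e i)| <= c) -> enorm v <= d%:R * c.
Proof.
move=> he c0 vc.
rewrite -(ger0_norm (mulr_ge0 (ler0n R d) c0)) -sqrtr_sqr /enorm ler_wsqrtr//.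
rewrite (parseval _ he); apply: (@le_trans _ _ (\sum_(i < d) c ^+ 2)).
  by apply: ler_sum => i _; rewrite -real_normK ?num_real// lerXn2r ?nnegrE.
rewrite sumr_const card_ord -[leLHS]mulr_natl exprMn ler_wpM2r ?sqr_ge0//.
by rewrite -natrX ler_nat; case: (d) => // n; rewrite leq_pmull.
Qed.

Lemma ler_entry_enorm (R : realType) (d : nat) (v : 'rV[R]_d) (j : 'I_d) :
  `|v 0 j| <= enorm v.
Proof.
rewrite -sqrtr_sqr /enorm ler_wsqrtr// /dotv (bigD1 j)//= -expr2 lerDl.
by rewrite sumr_ge0// => l _; rewrite -expr2 sqr_ge0.
Qed.

Lemma lattice_enorm_lt1 (R : realType) (d : nat) (u v : 'rV[R]_d) :
  @integer_lattice R d u -> @integer_lattice R d v -> enorm (u - v) < 1 ->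
  u = v.
Proof.
move=> /mxOverP hu /mxOverP hv uv1; apply/rowP => j; apply/eqP.
rewrite -subr_eq0; apply: contraT => uvj.
have : 1 <= `|(u - v) 0 j| by apply: norm_intr_ge1; rewrite !mxE ?rpredB.
by rewrite leNgt (le_lt_trans (ler_entry_enorm _ _) uv1).
Qed.

(** * Boxes parallel to the basis *)

(** Half-open, so that the cells of a subdivided box are pairwise disjoint and
    points chosen in different cells are distinct. *)
Definition box (R : realType) (d : nat) (e : d.-tuple 'rV[R]_d)
    (a : 'I_d -> R) (L : R) : set 'rV[R]_d :=
  [set v | forall i, a i <= dotv v (tnth e i) < a i + L].

Lemma enorm_box (R : realType) (d : nat) (e : d.-tuple 'rV[R]_d)
    (a : 'I_d -> R) (L : R) (u v : 'rV[R]_d) :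
  orthonormal_basis e -> 0 <= L -> box e a L u -> box e a L v ->
  enorm (u - v) <= d%:R * L.
Proof.
move=> he L0 hu hv; apply: (ler_enorm_coords he) => // i.
move: (hu i) (hv i) => /andP[? ?] /andP[? ?].
by rewrite dotvBl ler_norml; apply/andP; split; lra.
Qed.

Lemma lattice_box_eq (R : realType) (d : nat) (e : d.-tuple 'rV[R]_d)
    (a : 'I_d -> R) (u v : 'rV[R]_d) :
  orthonormal_basis e -> @integer_lattice R d u -> @integer_lattice R d v ->
  box e a d.+1%:R^-1 u -> box e a d.+1%:R^-1 v -> u = v.
Proof.
move=> he hu hv bu bv; apply: lattice_enorm_lt1 => //.
apply: le_lt_trans (enorm_box he _ bu bv) _; first by rewrite invr_ge0.
by rewrite ltr_pdivrMr ?ltr0n// mul1r ltr_nat.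
Qed.

Definition subbox (R : realType) (d : nat) (e : d.-tuple 'rV[R]_d)
    (a : 'I_d -> R) (l : R) (g : 'I_d -> nat) : set 'rV[R]_d :=
  box e (fun i => a i + l * (g i)%:R) l.

Lemma box_subbox (R : realType) (d : nat) (e : d.-tuple 'rV[R]_d)
    (a : 'I_d -> R) (l : R) (M : nat) (v : 'rV[R]_d) :
  0 < l -> box e a (l * M%:R) v ->
  exists g : {ffun 'I_d -> 'I_M}, subbox e a l (fun i => g i) v.
Proof.
move=> l0 hv.
have index (i : 'I_d) : exists n : 'I_M,
    a i + l * n%:R <= dotv v (tnth e i) < a i + l * n%:R + l.
  move: (hv i) => /andP[v1 v2]; set c := dotv v (tnth e i) in v1 v2 *.
  have c0 : 0 <= (c - a i) / l by rewrite divr_ge0 ?subr_ge0// ltW.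
  have /andP[n1 n2] := truncn_itv c0; set n := Num.truncn _ in n1 n2.
  have nM : (n < M)%N.
    rewrite -(ltr_nat R); apply: le_lt_trans n1 _.
    by rewrite ltr_pdivrMr// mulrC; lra.
  exists (Ordinal nM) => /=; move: n1 n2.
  rewrite ler_pdivlMr// ltr_pdivrMr// -natr1 mulrDl mul1r !(mulrC _ l).
  by move=> ? ?; apply/andP; split; lra.
have [g hg] := fin_all_exists index.
by exists [ffun i => g i] => i; rewrite ffunE.
Qed.

(** * Porosity of sets without approximate patches *)

(** The points [p x] of a patch with gap [Delta = l * m] are corners of
    pairwise disjoint cells of side [l].  A point of [F] in the cell of [p x]
    approximates [p x] well enough, because the cell has diameter at most
    [d * l], which is at most [eps * Delta]. *)
Lemma subboxes_AP (R : realType) (d k m : nat) (eps l : R)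
    (e : d.-tuple 'rV[R]_d) (F : set 'rV[R]_d) (a : 'I_d -> R) :
  orthonormal_basis e -> (0 < m)%N -> 0 < l -> d%:R <= eps * m%:R ->
  (forall x : {ffun 'I_d -> 'I_k},
     exists2 y, F y & subbox e a l (fun i => m * x i)%N y) ->
  contains_APs k eps e F.
Proof.
move=> he m0 l0 dm hF.
have point (x : {ffun 'I_d -> 'I_k}) :
    exists y, F y /\ subbox e a l (fun i => m * x i)%N y.
  by have [y ? ?] := hF x; exists y.
have [y hy] := fin_all_exists point.
pose Delta := l * m%:R.
have Delta0 : 0 < Delta by rewrite mulr_gt0// ltr0n.
pose p (x : {ffun 'I_d -> 'I_k}) : 'rV[R]_d :=
  \sum_i a i *: tnth e i + Delta *: \sum_i (x i)%:R *: tnth e i.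
have pE x i : dotv (p x) (tnth e i) = a i + Delta * (x i)%:R.
  by rewrite dotvDl dotvZl !dotv_combination.
have pbox (x : {ffun 'I_d -> 'I_k}) : subbox e a l (fun i => m * x i)%N (p x).
  move=> i; rewrite pE natrM /Delta mulrA lexx/=; lra.
have injp : injective p.
  move=> x1 x2 h; apply/ffunP => i; apply/val_inj/eqP => /=.
  rewrite -(eqr_nat R) -(inj_eq (mulfI (lt0r_neq0 Delta0))).
  by rewrite -(inj_eq (addrI (a i))) -!pE h.
have injy : injective y.
  move=> x1 x2 h; apply/ffunP => i; apply/val_inj/eqP => /=.
  move: (hy x1).2 (hy x2).2 => /(_ i) + /(_ i); rewrite h.
  move=> /andP[h1 h2] /andP[h3 h4].
  have lt1 : l * (m * x1 i)%:R < l * ((m * x2 i)%:R + 1) by lra.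
  have lt2 : l * (m * x2 i)%:R < l * ((m * x1 i)%:R + 1) by lra.
  move: lt1 lt2; rewrite !ltr_pM2l// !natr1 !ltr_nat !ltnS !leq_pmul2l//.
  by move=> ? ?; rewrite eqn_leq; apply/andP.
exists [set y x | x in [set: {ffun 'I_d -> 'I_k}]]; split.
  by move=> _ [x _ <-]; exact: (hy x).1.
exists Delta, [set p x | x in [set: {ffun 'I_d -> 'I_k}]]; split=> //.
- by exists (\sum_i a i *: tnth e i).
- apply: (@card_eq_trans _ _ _ _ [set: {ffun 'I_d -> 'I_k}]).
    by apply: inj_card_eq => x1 x2 _ _; exact: injy.
  by rewrite card_eq_sym; apply: inj_card_eq => x1 x2 _ _; exact: injp.
- apply: ge_ereal_sup => _ [_ [x _ <-] <-].
  apply: (@le_trans _ _ (enorm (p x - y x))%:E).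
    by apply: ereal_inf_lbound; exists (y x) => //; exists x.
  rewrite lee_fin (le_trans (enorm_box he (ltW l0) (pbox x) (hy x).2))//.
  by rewrite /Delta mulrCA mulrC ler_pM2l.
Qed.

(** The ratio [M] is the same at all places and scales; this uniformity is what
    allows the loss of one cell to be iterated. *)
Definition porous (R : realType) (d : nat) (e : d.-tuple 'rV[R]_d) (M : nat)
    (F : set 'rV[R]_d) : Prop :=
  forall (a : 'I_d -> R) (l : R), 0 < l ->
  exists g : {ffun 'I_d -> 'I_M},
    forall v, F v -> ~ subbox e a l (fun i => g i) v.

Lemma no_AP_porous (R : realType) (d k m : nat) (eps : R)
    (e : d.-tuple 'rV[R]_d) (F : set 'rV[R]_d) :
  orthonormal_basis e -> (0 < m)%N -> d%:R <= eps * m%:R ->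
  ~ contains_APs k eps e F -> porous e (m * k) F.
Proof.
move=> he m0 dm noAP a l l0; apply: contrapT => full.
apply: noAP; apply: (subboxes_AP he m0 l0 dm (a := a)) => x.
apply: contrapT => miss; apply: full.
have mxk (i : 'I_d) : (m * x i < m * k)%N by rewrite ltn_pmul2l.
exists [ffun i => Ordinal (mxk i)] => v Fv hv; apply: miss; exists v => // i.
by move: (hv i); rewrite ffunE.
Qed.

(** * Counting points of a porous set *)

Lemma size_le_cover (T : eqType) (I : finType) (A : pred I) (xs : seq T)
    (P : I -> pred T) (N : nat) :
  {in xs, forall v, exists2 i, A i & P i v} ->
  (forall i, A i -> (count (P i) xs <= N)%N) ->
  (size xs <= #|A| * N)%N.
Proof.
move=> cover bound.
apply: (@leq_trans (\sum_(i | A i) \sum_(v <- xs) P i v)%N); last first.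
  rewrite -sum_nat_const; apply: leq_sum => i Ai.
  by apply: leq_trans (bound i Ai); rewrite -sum1_count [leqRHS]big_mkcond.
rewrite exchange_big/= -sum1_size big_seq [leqRHS]big_seq.
apply: leq_sum => v /cover[i Ai Piv].
by rewrite (bigD1 i)//= Piv.
Qed.

(** Each generation of subdivision loses at least one cell, so it multiplies
    the count by at most [M ^ d - 1] rather than [M ^ d]; the recursion stops at
    side [s], where a box has at most one point. *)
Lemma porous_count (R : realType) (d : nat) (e : d.-tuple 'rV[R]_d) (M : nat)
    (F : set 'rV[R]_d) (s : R) :
  (0 < M)%N -> 0 < s -> porous e M F ->
  (forall a u v, F u -> F v -> box e a s u -> box e a s v -> u = v) ->
  forall (n : nat) (a : 'I_d -> R) (xs : seq 'rV[R]_d), uniq xs ->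
  {in xs, forall v, F v /\ box e a (s * M%:R ^+ n) v} ->
  (size xs <= (M ^ d - 1) ^ n)%N.
Proof.
move=> M0 s0 por sep; elim=> [|n IH] a xs uxs hxs.
  case: xs uxs hxs => [|u [|v xs]]//= + hxs.
  have [|Fu bu] := hxs u; first by rewrite !inE eqxx.
  have [|Fv bv] := hxs v; first by rewrite !inE eqxx orbT.
  rewrite expr0 mulr1 in bu bv.
  by rewrite (sep _ _ _ Fu Fv bu bv) inE eqxx.
pose l := s * M%:R ^+ n.
have l0 : 0 < l by rewrite mulr_gt0// exprn_gt0// ltr0n.
have [g0 hg0] := por a l l0.
have -> : ((M ^ d - 1) ^ n.+1 = #|predC1 g0| * (M ^ d - 1) ^ n)%N.
  by rewrite cardC1 card_ffun !card_ord expnS subn1.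
apply: (size_le_cover (A := predC1 g0)
  (P := fun g v => `[< subbox e a l (fun i => g i) v >])).
  move=> v /hxs[Fv]; rewrite exprSr mulrA => /(box_subbox l0)[g hg].
  exists g; last exact/asboolP.
  by apply/eqP => gg0; apply: (hg0 v Fv); rewrite -gg0.
move=> g _; rewrite -size_filter; apply: (IH (fun i => a i + l * (g i)%:R)).
  exact: filter_uniq.
by move=> v; rewrite mem_filter => /andP[/asboolP ? /hxs[]].
Qed.

(** * Convergence of the sum below the dimension *)

(** Summation by shells.  A point of [C n.+1] that is outside [C n] weighs at
    most [b n]; counting all of [C n.+1] instead of the shell alone costs
    nothing when [N] grows geometrically. *)
Lemma shell_sum_le (R : realType) (T : eqType) (w : T -> R) (S : set T)
    (C : nat -> set T) (N : nat -> nat) (b : nat -> R) :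
  (forall n, 0 <= b n) -> (forall v, S v -> ~ C 0 v) ->
  (forall n v, S v -> ~ C n v -> w v <= b n) ->
  (forall n (xs : seq T), uniq xs -> {in xs, forall v, S v /\ C n v} ->
     (size xs <= N n)%N) ->
  forall n (xs : seq T), uniq xs -> {in xs, forall v, S v /\ C n v} ->
  \sum_(v <- xs) w v <= \sum_(i < n) (N i.+1)%:R * b i.
Proof.
move=> b0 C0 wb count; elim=> [|n IH] xs uxs hxs.
  rewrite big_ord0; case: xs uxs hxs => [|v xs] _ hxs; first by rewrite big_nil.
  by have [] := hxs v; rewrite ?mem_head// => /C0.
rewrite big_ord_recr/= (bigID (fun v => `[< C n v >]))/=; apply: lerD.
  rewrite -big_filter; apply: IH; first exact: filter_uniq.
  by move=> v; rewrite mem_filter => /andP[/asboolP ? /hxs[]].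
apply: (@le_trans _ _ (\sum_(v <- xs) b n)); last first.
  rewrite big_const_seq count_predT iter_addr_0 -[leLHS]mulr_natl ler_wpM2r//.
  by rewrite ler_nat; exact: count.
rewrite big_mkcond/= big_seq [leRHS]big_seq; apply: ler_sum => v /hxs[Sv _].
by case: asboolP => //= nC; exact: wb.
Qed.

(** The inequality says [sigma > ln (M ^ d - 1) / ln M], and this quotient is
    less than [d] because [M ^ d - 1 < M ^ d]; the midpoint is a witness. *)
Lemma subcritical_exponent (R : realType) (d M : nat) :
  (1 <= d)%N -> (2 < M)%N ->
  exists sigma : R, [/\ 0 < sigma, sigma < d%:R &
    (M ^ d - 1)%:R * M%:R `^ (- sigma) < 1].
Proof.
move=> d1 M3; pose K := (M ^ d - 1)%N.
have MMd : (M <= M ^ d)%N by rewrite -{1}(expn1 M) leq_exp2l// (ltn_trans _ M3).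
have K1 : (1 < K)%N by rewrite ltn_subRL (leq_trans _ MMd).
have KMd : (K < M ^ d)%N.
  by rewrite /K subn1 prednK// (leq_trans _ MMd)// ltnW// ltnW.
have M0 : 0 < M%:R :> R by rewrite ltr0n (leq_trans _ M3).
have lnM0 : 0 < ln M%:R :> R by rewrite ln_gt0// ltr1n (leq_trans _ M3).
have K0 : 0 < K%:R :> R by rewrite ltr0n (leq_trans _ K1).
have lnK0 : 0 < ln K%:R :> R by rewrite ln_gt0// ltr1n.
have lnKM : ln K%:R < d%:R * ln M%:R :> R.
  by rewrite mulr_natl -lnXn// ltr_ln ?posrE ?exprn_gt0// -natrX ltr_nat.
pose sigma0 : R := ln K%:R / ln M%:R.
have sigma0_gt0 : 0 < sigma0 by rewrite divr_gt0.
have sigma0_lt : sigma0 < d%:R by rewrite ltr_pdivrMr.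
exists ((sigma0 + d%:R) / 2); split; [lra | lra |].
rewrite powRN ltr_pdivrMr ?powR_gt0// mul1r -ltr_ln ?posrE ?powR_gt0//.
rewrite ln_powR -ltr_pdivrMr// -/sigma0; lra.
Qed.

Definition cbox (R : realType) (d : nat) (e : d.-tuple 'rV[R]_d) (L : R) :
    set 'rV[R]_d :=
  box e (fun=> - (L / 2)) L.

Lemma notin_cbox (R : realType) (d : nat) (e : d.-tuple 'rV[R]_d) (L : R)
    (v : 'rV[R]_d) :
  orthonormal_basis e -> ~ cbox e L v -> L / 2 <= enorm v.
Proof.
move=> he out; rewrite leNgt; apply/negP => small; apply: out => i.
have := le_lt_trans (ler_coord_enorm v i he) small.
by rewrite ltr_norml => /andP[? ?]; apply/andP; split; lra.
Qed.

Lemma seq_sub_cbox (R : realType) (d : nat) (e : d.-tuple 'rV[R]_d) (s : R)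
    (M : nat) (xs : seq 'rV[R]_d) :
  orthonormal_basis e -> 0 < s -> (1 < M)%N ->
  exists n, {in xs, forall v, cbox e (s * M%:R ^+ n) v}.
Proof.
move=> he s0 M1; pose B := \sum_(v <- xs) enorm v.
have B0 : 0 <= B / (s / 2).
  by rewrite divr_ge0 ?sumr_ge0// => [v _|]; [exact: enorm_ge0 | lra].
have /andP[_] := truncn_itv B0; set n := (Num.truncn _).+1 => Bn.
exists n => v vxs; apply: contrapT => /(notin_cbox he).
rewrite leNgt mulrAC => /negP; apply.
have vB : enorm v <= B.
  rewrite /B (big_rem v)//= lerDl sumr_ge0// => u _; exact: enorm_ge0.
apply: le_lt_trans vB _; rewrite mulrC -ltr_pdivrMr; last by lra.
by apply: lt_le_trans Bn _; rewrite -natrX ler_nat ltnW// ltn_expl.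
Qed.

(** With [K = M ^ d - 1], shell [n] contributes at most [K ^ n.+1] terms of size
    [(s / 2 * M ^ n) `^ (- sigma)], so the shells are dominated by a geometric
    series of ratio [K * M `^ (- sigma)]. *)
Lemma porous_sum_lty (R : realType) (d : nat) (e : d.-tuple 'rV[R]_d)
    (M : nat) (F : set 'rV[R]_d) (s sigma : R) :
  orthonormal_basis e -> (1 < M)%N -> (0 < M ^ d - 1)%N -> 0 < s ->
  0 < sigma -> (M ^ d - 1)%:R * M%:R `^ (- sigma) < 1 ->
  porous e M F ->
  (forall a u v, F u -> F v -> box e a s u -> box e a s v -> u = v) ->
  (forall v, F v -> ~ cbox e s v) ->
  (\esum_(v in F) (enorm v `^ (- sigma))%:E < +oo)%E.
Proof.
move=> he M1 K0 s0 sigma0 r1 por sep far.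
set K := (M ^ d - 1)%N in K0 r1; set r := K%:R * M%:R `^ (- sigma) in r1.
have M0 : 0 < M%:R :> R by rewrite ltr0n ltnW.
have r0 : 0 < r by rewrite mulr_gt0 ?ltr0n// powR_gt0.
pose A := K%:R * (s / 2) `^ (- sigma).
have A0 : 0 <= A by rewrite mulr_ge0// powR_ge0.
pose b n := (s * M%:R ^+ n / 2) `^ (- sigma).
have shellE n : (K ^ n.+1)%:R * b n = A * r ^+ n.
  rewrite /b mulrAC powRM ?exprn_ge0 ?(ltW M0)//; last by lra.
  rewrite -powR_mulrn ?ltW// -powRrM (mulrC n%:R) powRrM.
  rewrite powR_mulrn ?powR_ge0// /A /r exprMn natrX exprS; ring.
apply: (@le_lt_trans _ _ (A / (1 - r))%:E); last by rewrite ltry.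
apply: ge_ereal_sup => _ [X [finX XF] <-].
rewrite fsbig_finite//= sumEFin lee_fin.
set xs := finmap.enum_fset _.
have xsF v : v \in xs -> F v.
  by move=> hv; apply: XF; move: hv; rewrite in_fset_set// inE.
have [n xsn] := seq_sub_cbox xs he s0 M1.
apply: (@le_trans _ _ (\sum_(i < n) (K ^ i.+1)%:R * b i)).
  apply: (@shell_sum_le _ _ _ F (fun n => cbox e (s * M%:R ^+ n))
            (fun n => K ^ n)%N b).
  - by move=> i; exact: powR_ge0.
  - by move=> v /far; rewrite expr0 mulr1.
  - move=> i v Fv /(notin_cbox he) hv; rewrite /b !powRN.
    have L0 : 0 < s * M%:R ^+ i / 2 by rewrite divr_gt0 ?mulr_gt0 ?exprn_gt0.
    rewrite lef_pV2 ?posrE ?powR_gt0 ?(lt_le_trans L0)//.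
    by apply: ge0_ler_powR; rewrite ?nnegrE ?enorm_ge0// ltW.
  - by move=> i; apply: porous_count => //; exact: ltnW.
  - exact: finmap.fset_uniq.
  - by move=> v hv; split; [exact: xsF | exact: xsn].
under eq_bigr do rewrite shellE.
have := @geometric_le_lim R n A r A0 r0; rewrite (ger0_norm (ltW r0)).
by move=> /(_ r1); rewrite /series /= big_mkord.
Qed.

Theorem corollary1p7 (R : realType) (d : nat) (hd : (1 <= d)%N)
    (F : set 'rV[R]_d) (hF : F `<=` @integer_lattice R d)
    (hdiv : forall sigma : R, 0 < sigma -> sigma < d%:R ->
      (\esum_(v in F `\ 0%R) (enorm v `^ (- sigma))%R%:E = +oo)%E)
    (k : nat) (hk : (3 <= k)%N)
    (eps : R) (heps0 : 0 < eps) (heps1 : eps < 1)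
    (e : d.-tuple 'rV[R]_d) (he : orthonormal_basis e) :
  contains_APs k eps e F.
Proof.
apply: contrapT => noAP.
pose m := (Num.truncn (d%:R / eps)).+1.
have dm : d%:R <= eps * m%:R.
  have /truncn_itv/andP[_ lt] : 0 <= d%:R / eps by rewrite divr_ge0// ltW.
  by rewrite mulrC -ler_pdivrMr// ltW.
have por := no_AP_porous he (ltn0Sn _) dm noAP.
set M := (_ * k)%N in por.
have M3 : (2 < M)%N by rewrite (leq_trans hk)// leq_pmull.
have K0 : (0 < M ^ d - 1)%N.
  by rewrite subn_gt0 (leq_trans _ (leq_pexp2l _ hd)) ?expn1// (leq_trans _ M3).
have [sigma [sigma0 sigmad r1]] := @subcritical_exponent R d M hd M3.
pose s : R := d.+1%:R^-1.
have s0 : 0 < s by rewrite invr_gt0 ltr0n.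
suff : (\esum_(v in F `\ 0%R) (enorm v `^ (- sigma))%R%:E < +oo)%E.
  by rewrite hdiv.
apply: (porous_sum_lty (M := M) (s := s) he _ K0 s0 sigma0 r1).
- exact: leq_trans M3.
- by move=> a l /(por a)[g hg]; exists g => v [/hg].
- by move=> a u v [/hF hu _] [/hF hv _]; exact: (lattice_box_eq he hu hv).
- move=> v [/hF hv v0] bv; apply: v0.
  (* The origin is itself a lattice point of the smallest centred box. *)
  apply: (lattice_box_eq he hv _ bv).
    by apply/mxOverP => i j; rewrite mxE rpred0.
  move=> i; rewrite [dotv _ _]big1; last by move=> j _; rewrite mxE mul0r.
  by apply/andP; split; rewrite -/s; lra.
Qed.
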